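(* Let $\mathcal{A}=\{\mathbf{m}_0,\mathbf{m}_1,\dots,\mathbf{m}_\ell\}\subset\mathbb{Z}^n$ be a finite set of (distinct) integer vectors with convex hull $\Delta\subset\mathbb{R}^n$, let $(Y_{\mathcal{A}})_{\geq}$ be the non-negative part of the projective toric variety $Y_{\mathcal{A}}\subset\mathbb{P}^\ell$, and let $\alpha_{\mathcal{A}}^{-1}\colon\Delta\to(Y_{\mathcal{A}})_{\geq}$ be the inverse of the homeomorphism $\alpha_{\mathcal{A}}\colon(Y_{\mathcal{A}})_{\geq}\to\Delta$. For $\mathbf{u}\in\Delta$ write $$\alpha_{\mathcal{A}}^{-1}(\mathbf{u})=[f_{\mathbf{m}}(\mathbf{u})\mid \mathbf{m}\in\mathcal{A}]\in\mathbb{P}^\ell,$$ where the homogeneous coordinates are the non-negative real representatives normalized so that $\sum_{\mathbf{m}\in\mathcal{A}}f_{\mathbf{m}}(\mathbf{u})=1$. Then the collection of coordinate functions $\{f_{\mathbf{m}}\mid\mathbf{m}\in\mathcal{A}\}$ of $\alpha_{\mathcal{A}}^{-1}$ has linear precision; that is, the functions $f_{\mathbf{m}}\colon\Delta\to\mathbb{R}$ are linearly independent and, for every affine function $\Lambda$ on $\mathbb{R}^n$, $$\Lambda(\mathbf{u})=\sum_{\mathbf{m}\in\mathcal{A}}\Lambda(\mathbf{m})\,f_{\mathbf{m}}(\mathbf{u})\qquad\text{for all }\mathbf{u}\in\Delta.$$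
   Context: For $\mathbf{t}=(t_1,\dots,t_n)\in(\mathbb{C}^* )^n$ and $\mathbf{a}=(a_1,\dots,a_n)\in\mathbb{Z}^n$, write $\mathbf{t}^{\mathbf{a}}=t_1^{a_1}\cdots t_n^{a_n}$. Given $\mathcal{A}=\{\mathbf{m}_0,\dots,\mathbf{m}_\ell\}\subset\mathbb{Z}^n$, define $\varphi_{\mathcal{A}}\colon(\mathbb{C}^* )^n\to\mathbb{P}^\ell$ (complex projective space) by $\mathbf{t}\mapsto[\mathbf{t}^{\mathbf{m}_0},\mathbf{t}^{\mathbf{m}_1},\dots,\mathbf{t}^{\mathbf{m}_\ell}]$. The homogeneous coordinates of $\mathbb{P}^\ell$ are indexed by the elements of $\mathcal{A}$, with $x_{\mathbf{m}_i}=x_i$. The projective toric variety $Y_{\mathcal{A}}$ is the closure of the image of $\varphi_{\mathcal{A}}$ in $\mathbb{P}^\ell$. The non-negative part $(Y_{\mathcal{A}})_{\geq}$ is the intersection of $Y_{\mathcal{A}}$ with $\{[x_0,\dots,x_\ell]\mid x_i\geq 0 \text{ for all } i\}$, the set of points of $\mathbb{P}^\ell$ having a representative with non-negative real homogeneous coordinates. The map $\alpha_{\mathcal{A}}\colon Y_{\mathcal{A}}\to\mathbb{R}^n$ is $$\alpha_{\mathcal{A}}(\mathbf{x})=\frac{1}{\sum_{\mathbf{m}\in\mathcal{A}}|x_{\mathbf{m}}|}\sum_{\mathbf{m}\in\mathcal{A}}|x_{\mathbf{m}}|\,\mathbf{m}.$$ On $(Y_{\mathcal{A}})_{\geq}$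 it coincides with the linear projection (the ''algebraic moment map'') $[x_0,\dots,x_\ell]\mapsto\left[\sum_i x_i,\ \sum_i x_i\mathbf{m}_i\right]\in\mathbb{P}^n$, where a point $\mathbf{v}\in\mathbb{R}^n$ is identified with $[1,\mathbf{v}]\in\mathbb{P}^n$. It is a known fact that $\alpha_{\mathcal{A}}$ restricts to a homeomorphism from $(Y_{\mathcal{A}})_{\geq}$ onto the convex hull $\Delta$ of $\mathcal{A}$; $\alpha_{\mathcal{A}}^{-1}$ denotes the inverse of this restriction. Linear precision: a collection of linearly independent functions $\{f_{\mathbf{m}}\mid\mathbf{m}\in\mathcal{A}\}$ defined on $\Delta$ has linear precision if for every affine function $\Lambda$ defined on $\mathbb{R}^n$ one has $\Lambda(\mathbf{u})=\sum_{\mathbf{m}\in\mathcal{A}}\Lambda(\mathbf{m})f_{\mathbf{m}}(\mathbf{u})$ for all $\mathbf{u}\in\Delta$. *)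

(* Defs.v *)
From HB Require Import structures.
From mathcomp Require Import all_boot all_order all_algebra.
From mathcomp Require Import generic_quotient.
From mathcomp Require Import boolp classical_sets functions reals.
From mathcomp Require Import complex.
(* Not imported: its notations clash with those of MathComp-Analysis. *)
From mathcomp Require mpoly.

Set Implicit Arguments.
Unset Strict Implicit.
Unset Printing Implicit Defensive.

Import Order.TTheory GRing.Theory Num.Theory.

Local Open Scope classical_set_scope.
Local Open Scope ring_scope.
Local Open Scope quotient_scope.
Local Open Scope complex_scope.

Definition nzvec (K : fieldType) (l : nat) := {v : 'rV[K]_l.+1 | v != 0}.

Definition proportional (K : fieldType) (l : nat) : rel (nzvec K l) :=
  fun v w => `[< exists2 c : K, c != 0 & val w = c *: val v >].

Lemma proportional_equiv (K : fieldType) (l : nat) :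
  equiv_class_of (@proportional K l).
Proof.
split=> [v|v w|w v z].
- by apply/asboolP; exists 1; rewrite ?oner_neq0 // scale1r.
- apply/asboolP/asboolP => -[c c0 e]; exists c^-1; rewrite ?invr_eq0 //.
    by rewrite e scalerA mulVf // scale1r.
  by rewrite e scalerA mulVf // scale1r.
- move=> /asboolP[c c0 e] /asboolP[d d0 f]; apply/asboolP.
  by exists (d * c); rewrite ?mulf_neq0 // f e scalerA.
Qed.

Canonical proportional_equivRel (K : fieldType) (l : nat) :=
  EquivRelPack (@proportional_equiv K l).

Definition projspace (K : fieldType) (l : nat) :=
  {eq_quot @proportional_equivRel K l}.

(* [v_0, ..., v_l] *)
Definition proj_class (K : fieldType) (l : nat) (v : 'rV[K]_l.+1)
    (v_neq0 : v != 0) : projspace K l :=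
  \pi_{eq_quot @proportional_equivRel K l} (exist _ v v_neq0 : nzvec K l).

Definition has_coords (K : fieldType) (l : nat) (x : projspace K l)
    (v : 'rV[K]_l.+1) : Prop :=
  exists v_neq0 : v != 0, x = proj_class v_neq0.

Definition coords (K : fieldType) (l : nat) (x : projspace K l) : 'rV[K]_l.+1 :=
  val (repr x : nzvec K l).

(* mpoly_mdeg__canonical__mpoly_Measure is the total degree mdeg, packed as the
   measure that ishomog1 expects. *)
Definition homogeneous (K : fieldType) (l : nat) (p : mpoly.mpoly l.+1 K) :
    Prop :=
  exists d : nat, p \is mpoly.ishomog1 d (mpoly.mpoly_mdeg__canonical__mpoly_Measure l.+1).

Definition zero_locus (K : fieldType) (l : nat) (S : set (mpoly.mpoly l.+1 K)) :
    set (projspace K l) :=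
  [set x | forall p, S p -> forall v, has_coords x v ->
     mpoly.meval (fun i => v 0 i) p = 0].

Definition zariski_closed (K : fieldType) (l : nat) (Z : set (projspace K l)) :
    Prop :=
  exists2 S : set (mpoly.mpoly l.+1 K),
    (forall p, S p -> homogeneous p) & Z = zero_locus S.

Definition zariski_closure (K : fieldType) (l : nat) (X : set (projspace K l)) :
    set (projspace K l) :=
  smallest (@zariski_closed K l) X.

Definition torus (K : fieldType) (n : nat) :=
  {t : 'rV[K]_n | [forall j, t 0 j != 0]}.

Definition monomial (K : fieldType) (n : nat) (t : 'rV[K]_n) (a : 'rV[int]_n) :
    K :=
  \prod_(j < n) t 0 j ^ a 0 j.

Definition monomials (K : fieldType) (n l : nat) (m : 'I_l.+1 -> 'rV[int]_n)
    (t : 'rV[K]_n) : 'rV[K]_l.+1 :=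
  \row_(i < l.+1) monomial t (m i).

Lemma monomials_neq0 (K : fieldType) (n l : nat) (m : 'I_l.+1 -> 'rV[int]_n)
  (t : torus K n) : monomials m (val t) != 0.
Proof.
apply/eqP => /rowP/(_ ord0); rewrite !mxE => /eqP; apply/negP.
apply/prodf_neq0 => j _; apply: expfz_neq0.
by case: t => t /= /forallP.
Qed.

(* A = {m_0, ..., m_l} is given by the family m; coordinate i of P^l is the one
   indexed by m_i. *)
Definition phi (K : fieldType) (n l : nat) (m : 'I_l.+1 -> 'rV[int]_n)
    (t : torus K n) : projspace K l :=
  proj_class (monomials_neq0 m t).

Definition toric_variety (R : realType) (n l : nat)
    (m : 'I_l.+1 -> 'rV[int]_n) : set (projspace R[i] l) :=
  zariski_closure (range (@phi R[i] n l m)).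

(* On R[i], [0 <= z] means that z is a nonnegative real number. *)
Definition toric_nonneg (R : realType) (n l : nat)
    (m : 'I_l.+1 -> 'rV[int]_n) : set (projspace R[i] l) :=
  toric_variety m `&`
  [set x | exists2 v : 'rV[R[i]]_l.+1, has_coords x v & forall i, 0 <= v 0 i].

Definition realvec (R : realType) (n : nat) (a : 'rV[int]_n) : 'rV[R]_n :=
  map_mx intr a.

(* Invariant under scaling, hence independent of the representative [coords x] *)
Definition alpha (R : realType) (n l : nat) (m : 'I_l.+1 -> 'rV[int]_n)
    (x : projspace R[i] l) : 'rV[R]_n :=
  (\sum_(i < l.+1) Normc.normc (coords x 0 i))^-1 *:
  \sum_(i < l.+1) Normc.normc (coords x 0 i) *: realvec R (m i).

Definition conv_hull (R : realType) (n l : nat) (m : 'I_l.+1 -> 'rV[int]_n) :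
    set 'rV[R]_n :=
  [set u | exists c : 'I_l.+1 -> R,
     [/\ forall i, 0 <= c i, \sum_(i < l.+1) c i = 1 &
         u = \sum_(i < l.+1) c i *: realvec R (m i)]].

Lemma one_in_torus (K : fieldType) (n : nat) :
  [forall j, (const_mx 1 : 'rV[K]_n) 0 j != 0].
Proof. by apply/forallP => j; rewrite mxE oner_neq0. Qed.

Definition torus_one (K : fieldType) (n : nat) : torus K n :=
  exist _ (const_mx 1) (one_in_torus K n).

(* The inverse of [alpha m] restricted to [toric_nonneg m]; outside the image
   of that restriction it takes an irrelevant default value. *)
Definition alpha_inv (R : realType) (n l : nat) (m : 'I_l.+1 -> 'rV[int]_n) :
    'rV[R]_n -> projspace R[i] l :=
  'pinv_(fun=> phi m (torus_one R[i] n)) (toric_nonneg m) (alpha m).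

Definition affine_function (R : realType) (n : nat) (Lam : 'rV[R]_n -> R) :
    Prop :=
  exists (L : {scalar 'rV[R]_n}) (b : R), forall u, Lam u = L u + b.

Definition lin_indep_on (R : realType) (n l : nat) (D : set 'rV[R]_n)
    (f : 'I_l.+1 -> 'rV[R]_n -> R) : Prop :=
  forall c : 'I_l.+1 -> R,
    (forall u, D u -> \sum_(i < l.+1) c i * f i u = 0) -> forall i, c i = 0.

Definition linear_precision (R : realType) (n l : nat)
    (m : 'I_l.+1 -> 'rV[int]_n) (f : 'I_l.+1 -> 'rV[R]_n -> R) : Prop :=
  lin_indep_on (conv_hull m) f /\
  forall Lam : 'rV[R]_n -> R, affine_function Lam ->
    forall u, conv_hull m u ->
      Lam u = \sum_(i < l.+1) Lam (realvec R (m i)) * f i u.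

(* f i u, for u in the convex hull, are the homogeneous coordinates of
   alpha_inv u that are real, nonnegative and of sum 1. *)
Definition alpha_inv_coordinates (R : realType) (n l : nat)
    (m : 'I_l.+1 -> 'rV[int]_n) (f : 'I_l.+1 -> 'rV[R]_n -> R) : Prop :=
  forall u, conv_hull m u ->
    [/\ forall i, 0 <= f i u,
        \sum_(i < l.+1) f i u = 1 &
        has_coords (alpha_inv m u) (\row_(i < l.+1) (f i u)%:C)].

(* Main.v *)
Require Import Defs.
From mathcomp Require Import all_boot all_order all_algebra reals.
From mathcomp Require mpoly.
From mathcomp Require Import complex.

(** Write Z_s for the sum of the exp<s, m_k>, and call the weights
    exp<s, m_i> / Z_s the Gibbs weights at s.  They are normalized homogeneous
    coordinates of the image under phi of the positive torus point e^s, so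
    [alpha] sends that image to their barycentre.

    Surjectivity of [alpha] gives the affine identity.  For u in the convex hull
    and eps > 0, the function sum_i exp<s, m_i - u> + eps |s|^2 has a minimizer,
    and the vanishing of its gradient says that the barycentre of the Gibbs
    weights differs from u by 2 eps s / Z, where Z = sum_i exp<s, m_i - u>.
    Since u is a convex combination of the m_i, Z is at least 1, and comparison
    with the value at 0 bounds eps |s|^2; so the error tends to 0 with eps
    ([moment_approx]).  The closure of the Gibbs weights is compact, hence some
    point p of it has barycentre exactly u ([moment_surjective]), and p lies on
    the toric variety because polynomials are continuous ([toric_closure]).
    Therefore [alpha_inv u] is a true preimage of u ([alpha_invP]); read in the
    coordinates f, this says that u is the barycentre of the m_i with weights
    f_i(u), and affine functions commute with barycentres.

    Linear independence needs that f takes the Gibbs weights as value at their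
    barycentre, that is, injectivity of [alpha] over those points
    ([toric_fibre_unique]).  A point of the toric variety with real coordinates
    p >= 0 satisfies all binomials coming from integer affine relations among
    the m_i.  If q > 0 has the same barycentre, q - p is a real affine relation;
    approximating a multiple of it by an integer relation gives a binomial that
    fails at p as soon as p has a zero coordinate.  So p > 0, the logarithms of
    p and of q are both orthogonal to the affine relations, and the sum of
    (q_i - p_i)(ln q_i - ln p_i) vanishes, which forces p = q.  A vanishing
    combination of the f_i is thus a vanishing combination of the functions
    exp<s, m_i>, and these are independent because the m_i are distinct
    ([gibbs_free]). *)

Set Implicit Arguments.
Unset Strict Implicit.
Unset Printing Implicit Defensive.

Import Order.TTheory GRing.Theory Num.Theory.
Local Open Scope ring_scope.

(** * Binomial forms *)

Module Binomials.
Import mpoly.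
Lemma binomial_polynomial (K : fieldType) (l : nat) (a b : 'I_l.+1 -> nat) :
  (\sum_i a i = \sum_i b i)%N ->
  exists2 p : {mpoly K[l.+1]}, homogeneous p &
    forall v, p.@[v] = \prod_i v i ^+ a i - \prod_i v i ^+ b i.
Proof.
move=> ab; exists ('X_[ [multinom a i | i < l.+1] ]
                 - 'X_[ [multinom b i | i < l.+1] ]); last first.
  move=> v; rewrite mevalB !mevalX.
  by congr (_ - _); apply: eq_bigr => i _; rewrite mnmE.
exists (\sum_i a i)%N; apply: rpredB; rewrite dhomogX /= mdegE; apply/eqP.
  by apply: eq_bigr => i _; rewrite mnmE.
by rewrite ab; apply: eq_bigr => i _; rewrite mnmE.
Qed.
End Binomials.

From mathcomp Require Import boolp classical_sets functions.
From mathcomp Require Import topology normedtype derive realfun.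
From mathcomp Require Import sequences exp.
From mathcomp Require Import ring lra.
Import numFieldNormedType.Exports.
Local Open Scope classical_set_scope.
Local Open Scope ring_scope.
Local Open Scope complex_scope.

(** * Homogeneous coordinates *)

Lemma has_coords_proportional (K : fieldType) (l : nat) (x : projspace K l)
    (v w : 'rV[K]_l.+1) :
  has_coords x v -> has_coords x w -> exists2 c : K, c != 0 & w = c *: v.
Proof.
move=> [v0 ->] [w0 e].
have /eqmodP := e.
by move=> /asboolP.
Qed.

Lemma has_coordsZ (K : fieldType) (l : nat) (x : projspace K l)
    (v : 'rV[K]_l.+1) (c : K) :
  c != 0 -> has_coords x v -> has_coords x (c *: v).
Proof.
move=> c0 [v0 ->]; have cv0 : c *: v != 0 by rewrite scaler_eq0 negb_or c0.
by exists cv0; apply/eqmodP/asboolP; exists c.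
Qed.

Lemma has_coords_coords (K : fieldType) (l : nat) (x : projspace K l) :
  has_coords x (coords x).
Proof.
exists (valP (repr x)); rewrite /proj_class.
by rewrite -[LHS]reprK; congr (\pi_ _ _)%qT; apply: val_inj.
Qed.

Lemma phi_coords (K : fieldType) (n l : nat) (m : 'I_l.+1 -> 'rV[int]_n)
    (t : torus K n) : has_coords (phi m t) (monomials m (val t)).
Proof. by exists (monomials_neq0 m t). Qed.

(** * Real coordinates and the moment map *)

Definition complexify (R : realType) (k : nat) (p : 'rV[R]_k) : 'rV[R[i]]_k :=
  \row_i (p 0 i)%:C.

Definition moment (R : realType) (n l : nat) (m : 'I_l.+1 -> 'rV[int]_n)
    (p : 'rV[R]_l.+1) : 'rV[R]_n :=
  \sum_i p 0 i *: realvec R (m i).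

Lemma momentE (R : realType) (n l : nat) (m : 'I_l.+1 -> 'rV[int]_n)
    (p : 'rV[R]_l.+1) j : moment m p 0 j = \sum_i p 0 i * (m i 0 j)%:~R.
Proof. by rewrite summxE; apply: eq_bigr => i _; rewrite !mxE. Qed.

Definition in_simplex (R : realType) (l : nat) (p : 'rV[R]_l.+1) : Prop :=
  (forall i, 0 <= p 0 i) /\ \sum_i p 0 i = 1.

Lemma normc_real (R : realType) (a : R) : 0 <= a -> Normc.normc a%:C = a.
Proof. by move=> a0; rewrite /= expr0n addr0 sqrtr_sqr ger0_norm. Qed.

Lemma complexify_neq0 (R : realType) (l : nat) (p : 'rV[R]_l.+1) :
  in_simplex p -> complexify p != 0.
Proof.
move=> [_ p1]; apply/eqP => /rowP p0; move/eqP: p1; rewrite big1 => [|i _].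
  by rewrite eq_sym oner_eq0.
by have := p0 i; rewrite !mxE => -[].
Qed.

(** [alpha] is computed on an arbitrary choice of representative; on a real
    normalized one it becomes the barycentre map. *)
Lemma alpha_moment (R : realType) (n l : nat) (m : 'I_l.+1 -> 'rV[int]_n)
    (x : projspace R[i] l) (p : 'rV[R]_l.+1) :
  in_simplex p -> has_coords x (complexify p) -> alpha m x = moment m p.
Proof.
move=> [p0 p1] xp.
have [c c0 e] := has_coords_proportional xp (has_coords_coords x).
have eN i : Normc.normc (coords x 0 i) = Normc.normc c * p 0 i.
  by rewrite e !mxE Normc.normcM normc_real.
have cN : Normc.normc c != 0.
  by apply: contra_neq c0; exact: Normc.eq0_normc.
rewrite /alpha (eq_bigr _ (fun i _ => eN i)) -mulr_sumr p1 mulr1.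
under eq_bigr do rewrite eN -scalerA.
by rewrite -scaler_sumr scalerA mulVf // scale1r.
Qed.

Lemma toric_nonneg_real (R : realType) (n l : nat)
    (m : 'I_l.+1 -> 'rV[int]_n) (x : projspace R[i] l) (p : 'rV[R]_l.+1) :
  toric_variety m x -> in_simplex p -> has_coords x (complexify p) ->
  toric_nonneg m x.
Proof.
move=> Yx [p0 _] xp; split=> //; exists (complexify p) => // i.
by rewrite mxE ler0c.
Qed.

(** * The positive real points of the torus *)

Definition pairing (R : realType) (n : nat) (s : 'rV[R]_n) (a : 'rV[int]_n) :
    R := \sum_j s 0 j * (a 0 j)%:~R.

Definition partition_function (R : realType) (n l : nat)
    (m : 'I_l.+1 -> 'rV[int]_n) (s : 'rV[R]_n) : R :=
  \sum_i expR (pairing s (m i)).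

(** These are the normalized coordinates of the image under phi of the positive
    torus point (e^s_1, ..., e^s_n). *)
Definition gibbs (R : realType) (n l : nat) (m : 'I_l.+1 -> 'rV[int]_n)
    (s : 'rV[R]_n) : 'rV[R]_l.+1 :=
  \row_i (expR (pairing s (m i)) / partition_function m s).

Lemma partition_function_gt0 (R : realType) (n l : nat)
    (m : 'I_l.+1 -> 'rV[int]_n) (s : 'rV[R]_n) : 0 < partition_function m s.
Proof.
rewrite /partition_function big_ord_recl ltr_pwDl ?expR_gt0 //.
by apply: sumr_ge0 => i _; rewrite expR_ge0.
Qed.

Lemma gibbs_gt0 (R : realType) (n l : nat) (m : 'I_l.+1 -> 'rV[int]_n)
    (s : 'rV[R]_n) i : 0 < gibbs m s 0 i.
Proof. by rewrite mxE divr_gt0 ?expR_gt0 ?partition_function_gt0. Qed.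

Lemma gibbs_simplex (R : realType) (n l : nat) (m : 'I_l.+1 -> 'rV[int]_n)
    (s : 'rV[R]_n) : in_simplex (gibbs m s).
Proof.
split=> [i|]; first exact/ltW/gibbs_gt0.
under eq_bigr do rewrite mxE.
by rewrite -mulr_suml mulfV // gt_eqF // partition_function_gt0.
Qed.

Lemma exp_torus_proof (R : realType) (n : nat) (s : 'rV[R]_n) :
  [forall j, (\row_j (expR (s 0 j))%:C) 0 j != 0 :> R[i]].
Proof. by apply/forallP => j; rewrite mxE eq_complex /= expR_eq0. Qed.

Definition exp_torus (R : realType) (n : nat) (s : 'rV[R]_n) : torus R[i] n :=
  exist _ (\row_j (expR (s 0 j))%:C) (exp_torus_proof s).

Lemma expR_exprz (R : realType) (x : R) (a : int) :
  expR x ^ a = expR (x * a%:~R).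
Proof.
case: a => k; first by rewrite -exprnP expRM_natr.
by rewrite NegzE -exprnN -expRM_natr -expRN rmorphN /= mulrN.
Qed.

Lemma monomials_exp_torus (R : realType) (n l : nat)
    (m : 'I_l.+1 -> 'rV[int]_n) (s : 'rV[R]_n) :
  monomials m (val (exp_torus s)) =
    (partition_function m s)%:C *: complexify (gibbs m s).
Proof.
apply/rowP => i; rewrite !mxE -rmorphM /= mulrC divfK; last first.
  by rewrite gt_eqF ?partition_function_gt0.
rewrite /monomial expR_sum rmorph_prod; apply: eq_bigr => j _.
by rewrite mxE -expR_exprz [RHS]rmorphXz // unitfE expR_eq0.
Qed.

Lemma phi_gibbs (R : realType) (n l : nat) (m : 'I_l.+1 -> 'rV[int]_n)
    (s : 'rV[R]_n) :
  has_coords (phi m (exp_torus s)) (complexify (gibbs m s)).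
Proof.
have Z0 : (partition_function m s)%:C != 0 :> R[i].
  by rewrite eq_complex /= eqxx andbT gt_eqF ?partition_function_gt0.
have := phi_coords m (exp_torus s); rewrite monomials_exp_torus.
move=> /(has_coordsZ (invr_neq0 Z0)).
by rewrite scalerA mulVf // scale1r.
Qed.

(** * Equations of the toric variety at real points *)

Lemma prod_monomialX (K : fieldType) (n k : nat) (m : 'I_k -> 'rV[int]_n)
    (t : 'rV[K]_n) (a : 'I_k -> nat) :
  (forall j, t 0 j != 0) ->
  \prod_i monomial t (m i) ^+ a i = monomial t (\sum_i m i *+ a i).
Proof.
move=> t0; rewrite /monomial.
under eq_bigr do rewrite -prodrXl.
rewrite exchange_big /=; apply: eq_bigr => j _.
rewrite summxE.
elim/big_rec2: _ => [|i y1 y2 _ ->]; first by rewrite expr0z.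
by rewrite mulmxnE expfzDr // exprnP exprz_exp -mulr_natr natz.
Qed.

(** The binomial with exponents a and b vanishes on the torus image, where it
    only depends on the two equal exponents sum_i a_i m_i and sum_i b_i m_i;
    the degrees agree, so it is homogeneous and vanishes on the closure. *)
Lemma toric_binomial (R : realType) (n l : nat) (m : 'I_l.+1 -> 'rV[int]_n)
    (x : projspace R[i] l) (p : 'rV[R]_l.+1) (a b : 'I_l.+1 -> nat) :
  toric_variety m x -> has_coords x (complexify p) ->
  (\sum_i a i = \sum_i b i)%N ->
  \sum_i m i *+ a i = \sum_i m i *+ b i ->
  \prod_i p 0 i ^+ a i = \prod_i p 0 i ^+ b i.
Proof.
move=> Yx xp ab mab.
have [P homP evP] := Binomials.binomial_polynomial R[i] ab.
have /Yx zx : zariski_closed (zero_locus [set P]) /\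
    range (phi (K:=R[i]) m) `<=` zero_locus [set P].
  split; first by exists [set P] => // _ ->.
  move=> _ [t _ <-] _ -> v tv.
  have [c c0 ->] := has_coords_proportional (phi_coords m t) tv.
  have t0 j : val t 0 j != 0 by case: (t) => ? /= /forallP.
  have E (d : 'I_l.+1 -> nat) :
      \prod_i (c *: monomials m (val t)) 0 i ^+ d i =
      c ^+ (\sum_i d i) * monomial (val t) (\sum_i m i *+ d i).
    under eq_bigr do rewrite !mxE exprMn.
    by rewrite big_split /= prodrXr prod_monomialX.
  by rewrite evP !E ab mab subrr.
have := zx P erefl _ xp; rewrite evP => /subr0_eq.
have E (d : 'I_l.+1 -> nat) : \prod_i complexify p 0 i ^+ d i =
    (\prod_i p 0 i ^+ d i)%:C.
  by rewrite rmorph_prod; apply: eq_bigr => i _; rewrite mxE rmorphXn.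
by rewrite !E => -[].
Qed.

Lemma continuous_add (R : realType) (T : topologicalType) (F G : T -> R) :
  continuous F -> continuous G -> continuous (fun x => F x + G x).
Proof. by move=> cF cG x; exact: (cvgD (cF x) (cG x)). Qed.

Lemma continuous_mul (R : realType) (T : topologicalType) (F G : T -> R) :
  continuous F -> continuous G -> continuous (fun x => F x * G x).
Proof. by move=> cF cG x; exact: (cvgM (cF x) (cG x)). Qed.

Lemma continuous_sum (R : realType) (T : topologicalType) (I : Type)
    (r : seq I) (F : I -> T -> R) :
  (forall i, continuous (F i)) -> continuous (fun x => \sum_(i <- r) F i x).
Proof.
by move=> cF; apply: continuous_big => //; exact: add_continuous.
Qed.

Lemma continuous_monomial (R : realType) (k : nat) (a : 'I_k -> nat) :
  continuous (fun p : 'rV[R]_k => \prod_i p 0 i ^+ a i).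
Proof.
apply: continuous_big => [|i _ p]; first exact: mul_continuous.
apply: (@continuous_comp _ _ _ (fun q : 'rV[R]_k => q 0 i)
  (fun y => y ^+ a i)); first exact: coord_continuous.
exact: exprn_continuous.
Qed.

Lemma closure_preimage (R : realType) (T : topologicalType) (E : set T)
    (g : T -> R) (D : set R) (x : T) :
  closed D -> continuous g -> (forall y, E y -> D (g y)) -> closure E x ->
  D (g x).
Proof.
move=> cD cg gE; suff /(_ x) : closure E `<=` g @^-1` D by [].
have /closure_id -> := closed_comp (fun y _ => cg y) cD.
exact: closure_subset.
Qed.

(** The Zariski closure contains the Euclidean limits of torus points, as real
    and imaginary parts of polynomials are continuous.  The fixed scalar c turns
    normalized representatives into arbitrary ones. *)
Lemma toric_closure (R : realType) (n l : nat) (m : 'I_l.+1 -> 'rV[int]_n)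
    (x : projspace R[i] l) (p : 'rV[R]_l.+1) :
  closure (range (@gibbs R n l m)) p -> has_coords x (complexify p) ->
  toric_variety m x.
Proof.
move=> Ep xp _ [[S _ ->] Zphi] P SP v xv.
have [c c0 ->] := has_coords_proportional xp xv.
pose ev q := mpoly.meval (fun i => (c *: complexify q) 0 i) P.
have evE q : ev q = \sum_(e <- mpoly.msupp P)
    mpoly.mcoeff e P * (\prod_i c ^+ mpoly.fun_of_multinom e i) *
    (\prod_i q 0 i ^+ mpoly.fun_of_multinom e i)%:C.
  rewrite /ev mpoly.mevalE; apply: eq_bigr => e _; rewrite -mulrA.
  rewrite rmorph_prod -big_split; congr (_ * _).
  by apply: eq_bigr => i _; rewrite !mxE exprMn rmorphXn.
have ev0 q : range (@gibbs R n l m) q -> ev q = 0.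
  move=> [s _ <-].
  have /Zphi zq : range (phi (K:=R[i]) m) (phi m (exp_torus s)).
    by exists (exp_torus s).
  exact: (zq P SP _ (has_coordsZ c0 (phi_gibbs m s))).
have part0 (f : {additive R[i] -> R}) :
    (forall z r, f (z * r%:C) = f z * r) -> f (ev p) = 0.
  move=> fM.
  apply: (closure_preimage (@closed_eq R 0) (g := f \o ev)) Ep
    => [|q /ev0 /= ->].
    rewrite (_ : f \o ev = fun q : 'rV[R]_l.+1 => \sum_(e <- mpoly.msupp P)
        f (mpoly.mcoeff e P * \prod_i c ^+ mpoly.fun_of_multinom e i) *
        \prod_i q 0 i ^+ mpoly.fun_of_multinom e i).
      apply: continuous_sum => e; apply: continuous_mul.
        by move=> q; exact: cst_continuous.
      exact: continuous_monomial.
    apply/funext => q /=; rewrite evE raddf_sum.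
    by apply: eq_bigr => e _; rewrite fM.
  exact: raddf0.
have re : complex.Re (ev p) = 0.
  by apply: part0 => -[a b] r /=; rewrite mulr0 subr0.
have im : complex.Im (ev p) = 0.
  by apply: part0 => -[a b] r /=; rewrite mulr0 add0r mulrC.
by move: re im; rewrite -/(ev p); case: (ev p) => a b /= -> ->.
Qed.

(** * Surjectivity of the moment map *)

(** One coordinate of the gradient equation for the penalized exponential sum
    below: a minimum at h = 0 has zero derivative. *)
Lemma critical_point_penalized (R : realType) (k : nat) (A b : 'I_k -> R)
    (eps c t : R) :
  (forall h, \sum_i expR (A i) + eps * c <=
     \sum_i expR (A i + h * b i) + eps * (c + h * t *+ 2 + h ^+ 2)) ->
  \sum_i expR (A i) * b i = - (eps * t *+ 2).
Proof.
move=> gmin.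
pose g (h : R) : R :=
  \sum_i expR (A i + h * b i) + eps * (c + h * t *+ 2 + h ^+ 2).
have dg (h : R) : is_derive h 1 g
    (\sum_i expR (A i + h * b i) * b i + eps * (t *+ 2 + h *+ 2)).
  have -> : g = \sum_i (fun h : R => expR (A i + h * b i) : R) +
                (fun h : R => eps * (c + h * t *+ 2 + h ^+ 2) : R).
    by apply/funext => y; rewrite /g fctE fct_sumE.
  apply: is_deriveD.
    apply: is_derive_sum => i.
    rewrite -[X in is_derive _ _ X _]/(expR \o (fun h : R => A i + h * b i)).
    apply: is_derive1_comp.
    apply: is_derive_eq.
    by rewrite /GRing.scale /=; ring.
  apply: is_derive_eq.
  by rewrite /GRing.scale /=; ring.
have dg0 : is_derive (0 : R) 1 g 0.
  apply: (@derive1_at_min R g (-1) 1 0).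
  - by lra.
  - by move=> h _; exact: ex_derive.
  - by rewrite in_itv /=; lra.
  - move=> h _; rewrite /g !mul0r expr0n !addr0 mul0rn addr0.
    by under eq_bigr do rewrite mul0r addr0.
have := @derive_val _ _ _ _ _ _ _ (dg 0); rewrite derive_val => /esym.
rewrite mul0rn addr0; under eq_bigr do rewrite mul0r addr0.
by rewrite mulrnAr => /eqP; rewrite addr_eq0 => /eqP.
Qed.

(** This is the exponent <s, m_i - u>; dividing all exp<s, m_i> by exp<s, u>
    does not change the Gibbs weights and centres the problem at u. *)
Definition tilt (R : realType) (n l : nat) (m : 'I_l.+1 -> 'rV[int]_n)
    (u s : 'rV[R]_n) (i : 'I_l.+1) : R :=
  \sum_j s 0 j * ((m i 0 j)%:~R - u 0 j).

Lemma tilt_pairing (R : realType) (n l : nat) (m : 'I_l.+1 -> 'rV[int]_n)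
    (u s : 'rV[R]_n) i :
  tilt m u s i = pairing s (m i) - \sum_j s 0 j * u 0 j.
Proof. by rewrite -sumrB; apply: eq_bigr => j _; rewrite mulrBr. Qed.

Lemma gibbs_tilt (R : realType) (n l : nat) (m : 'I_l.+1 -> 'rV[int]_n)
    (u s : 'rV[R]_n) i :
  gibbs m s 0 i = expR (tilt m u s i) / \sum_k expR (tilt m u s k).
Proof.
have E k : expR (tilt m u s k) =
    expR (- \sum_j s 0 j * u 0 j) * expR (pairing s (m k)).
  by rewrite tilt_pairing addrC expRD.
rewrite mxE E [in RHS](eq_bigr _ (fun k _ => E k)).
by rewrite -mulr_sumr -mulf_div divff ?mul1r // expR_eq0.
Qed.

(** With u = sum_i c_i m_i, the tilts have c-average 0, so the c-average of
    their exponentials is at least 1 by e^x >= 1 + x; and the weights c_i are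
    at most 1. *)
Lemma tilt_sum_ge1 (R : realType) (n l : nat) (m : 'I_l.+1 -> 'rV[int]_n)
    (u s : 'rV[R]_n) :
  conv_hull m u -> 1 <= \sum_i expR (tilt m u s i).
Proof.
move=> [c [c0 c1 uE]].
have tilt0 : \sum_i c i * tilt m u s i = 0.
  under eq_bigr do rewrite /tilt mulr_sumr.
  rewrite exchange_big big1 // => j _.
  have -> : u 0 j = \sum_i c i * (m i 0 j)%:~R.
    by rewrite uE summxE; apply: eq_bigr => i _; rewrite !mxE.
  under eq_bigr do rewrite mulrCA mulrBr.
  by rewrite -mulr_sumr sumrB -mulr_suml c1 mul1r subrr mulr0.
have -> : 1 = \sum_i c i * (1 + tilt m u s i).
  under eq_bigr do rewrite mulrDr mulr1.
  by rewrite big_split /= c1 tilt0 addr0.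
apply: ler_sum => i _.
have ci1 : c i <= 1.
  by rewrite -c1 (bigD1 i) //= lerDl sumr_ge0.
apply: (@le_trans _ _ (c i * expR (tilt m u s i))).
  by rewrite ler_wpM2l // expR_ge1Dx.
by rewrite ler_piMl ?expR_ge0.
Qed.

(** The convex function whose unpenalized critical points are the s with
    Gibbs barycentre u.  For u on the relative boundary of the hull there
    is none; the quadratic term forces a minimum to exist. *)
Definition penalized (R : realType) (n l : nat) (m : 'I_l.+1 -> 'rV[int]_n)
    (u : 'rV[R]_n) (eps : R) (s : 'rV[R]_n) : R :=
  \sum_i expR (tilt m u s i) + eps * \sum_j s 0 j ^+ 2.

Lemma continuous_penalized (R : realType) (n l : nat)
    (m : 'I_l.+1 -> 'rV[int]_n) (u : 'rV[R]_n) (eps : R) :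
  continuous (penalized m u eps).
Proof.
rewrite /penalized; apply: continuous_add.
  apply: continuous_sum => i x.
  apply: (@continuous_comp _ _ _ (fun x => tilt m u x i) expR).
    rewrite /tilt; apply: continuous_sum => j; apply: continuous_mul => [|y].
      exact: coord_continuous.
    exact: cst_continuous.
  exact: continuous_expR.
apply: continuous_mul; first by move=> y; exact: cst_continuous.
apply: continuous_sum => j y.
apply: (@continuous_comp _ _ _ (fun q : 'rV[R]_n => q 0 j) (fun y => y ^+ 2)).
  exact: coord_continuous.
exact: exprn_continuous.
Qed.

Lemma penalized0 (R : realType) (n l : nat) (m : 'I_l.+1 -> 'rV[int]_n)
    (u : 'rV[R]_n) (eps : R) : penalized m u eps 0 = l.+1%:R.
Proof.
rewrite /penalized [X in eps * X]big1 => [|j _]; last by rewrite mxE expr0n.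
rewrite mulr0 addr0 -[RHS]mulr1 -[l.+1 in RHS]card_ord mulr_natl -sumr_const.
apply: eq_bigr => i _; rewrite /tilt big1 ?expR0 // => j _.
by rewrite mxE mul0r.
Qed.

(** Outside a box the quadratic term alone exceeds the value at 0, so a minimum
    over the compact box is global. *)
Lemma penalized_min (R : realType) (n l : nat) (m : 'I_l.+1 -> 'rV[int]_n)
    (u : 'rV[R]_n) (eps : R) :
  0 < eps -> exists s, forall s', penalized m u eps s <= penalized m u eps s'.
Proof.
move=> eps0; pose B : R := 1 + l.+1%:R / eps.
have B1 : 1 <= B by rewrite lerDl divr_ge0 // ltW.
have B0 : 0 <= B by apply: le_trans B1.
(* l + 1 is the value at 0; since B >= 1, already eps * B exceeds it. *)
have BE : l.+1%:R <= eps * B ^+ 2.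
  rewrite -ler_pdivrMl // mulrC.
  apply: (@le_trans _ _ B); first by rewrite lerDr.
  by rewrite expr2 ler_peMl.
pose box : set 'rV[R]_n := [set v | forall j, [set` `[- B, B]] (v ord0 j)].
have cbox : compact box.
  apply: (@rV_compact R n (fun=> [set` `[- B, B]])) => j.
  exact: segment_compact.
have box0 : box 0 by move=> j; rewrite /= mxE in_itv /= oppr_le0 B0.
have [s _ smin] := EVT_min_rV (ex_intro _ _ box0) cbox
  (continuous_subspaceT (@continuous_penalized R n l m u eps)).
exists s => s'; have [s'box|] := pselect (box s').
  by apply: smin; rewrite inE.
move=> /existsNP[j]; rewrite /= in_itv /= -ler_norml => /negP; rewrite -ltNge.
move=> Bj; apply: (@le_trans _ _ l.+1%:R).
  by rewrite -(penalized0 m u eps); apply: smin; rewrite inE.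
apply: (le_trans BE); rewrite /penalized -[leLHS]add0r lerD //.
  by apply: sumr_ge0 => i _; rewrite expR_ge0.
apply: ler_wpM2l; first exact: ltW.
rewrite (bigD1 j) //= -[leLHS]addr0 lerD //.
  by rewrite -[leRHS]real_normK ?num_real // lerXn2r ?nnegrE // ltW.
by apply: sumr_ge0 => k _; rewrite sqr_ge0.
Qed.

Lemma penalized_critical (R : realType) (n l : nat)
    (m : 'I_l.+1 -> 'rV[int]_n) (u : 'rV[R]_n) (eps : R) (s : 'rV[R]_n) j :
  (forall s', penalized m u eps s <= penalized m u eps s') ->
  \sum_i expR (tilt m u s i) * ((m i 0 j)%:~R - u 0 j) = - (eps * s 0 j *+ 2).
Proof.
move=> smin.
apply: (@critical_point_penalized _ _ _ _ _ (\sum_j s 0 j ^+ 2)) => h.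
pose v : 'rV[R]_n := \row_k (k == j)%:R.
have vE (w : 'I_n -> R) : \sum_k (v 0 k) * w k = w j.
  rewrite (bigD1 j) //= mxE eqxx mul1r big1 ?addr0 // => k kj.
  by rewrite mxE (negbTE kj) mul0r.
apply: (le_trans (smin (s + h *: v))).
rewrite /penalized le_eqVlt; apply/orP; left; apply/eqP; congr (_ + _ * _).
  apply: eq_bigr => i _; congr expR.
  rewrite -(vE (fun k => (m i 0 k)%:~R - u 0 k)) mulr_sumr -big_split /=.
  by apply: eq_bigr => k _; rewrite !mxE mulrDl mulrA.
have vv k : v 0 k ^+ 2 = v 0 k.
  by rewrite mxE; case: eqP; rewrite ?expr1n ?expr0n.
transitivity (\sum_k (s 0 k ^+ 2 + v 0 k * (h * s 0 k *+ 2) + v 0 k * h ^+ 2)).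
  apply: eq_bigr => k _; rewrite [(s + _) _ _]mxE [(h *: v) _ _]mxE.
  by rewrite sqrrD exprMn vv; ring.
by rewrite !big_split /= !vE.
Qed.

(** At the minimizer s, the gradient equation gives the error -2 eps s / Z with
    Z >= 1, and the value at 0 gives eps |s|^2 <= l + 1; hence the squared
    error is at most 4 eps (l + 1). *)
Lemma moment_approx (R : realType) (n l : nat) (m : 'I_l.+1 -> 'rV[int]_n)
    (u : 'rV[R]_n) (e : R) :
  conv_hull m u -> 0 < e ->
  exists s, \sum_j (moment m (gibbs m s) 0 j - u 0 j) ^+ 2 <= e.
Proof.
move=> hu e0; pose eps : R := e / (4 * l.+1%:R).
have N0 : 0 < l.+1%:R :> R by rewrite ltr0n.
have eps0 : 0 < eps by rewrite divr_gt0 // mulr_gt0.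
have [s smin] := penalized_min m u eps0; exists s.
pose Z := \sum_i expR (tilt m u s i).
have Z1 : 1 <= Z := tilt_sum_ge1 s hu.
have Z0 : 0 < Z by apply: lt_le_trans Z1.
have errE j : moment m (gibbs m s) 0 j - u 0 j = - (eps * s 0 j *+ 2) / Z.
  rewrite -(penalized_critical j smin) mulr_suml momentE.
  have {1}-> : u 0 j = \sum_i gibbs m s 0 i * u 0 j.
    by rewrite -mulr_suml (gibbs_simplex m s).2 mul1r.
  rewrite -sumrB.
  by apply: eq_bigr => i _; rewrite -mulrBr (gibbs_tilt m u) mulrAC.
have small : eps * \sum_j s 0 j ^+ 2 <= l.+1%:R.
  rewrite -(penalized0 m u eps); apply: le_trans (smin 0).
  by rewrite lerDr sumr_ge0 // => i _; rewrite expR_ge0.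
have bound j : (moment m (gibbs m s) 0 j - u 0 j) ^+ 2 <=
    4 * eps * (eps * s 0 j ^+ 2).
  rewrite errE exprMn exprVn.
  rewrite (_ : (- _) ^+ 2 = 4 * eps * (eps * s 0 j ^+ 2)); last by ring.
  apply: ler_piMr.
    by apply: mulr_ge0; apply: mulr_ge0; rewrite ?sqr_ge0 ?ler0n ?(ltW eps0).
  by rewrite invf_le1 ?exprn_gt0 // exprn_ege1.
apply: (le_trans (ler_sum _ (fun j _ => bound j))).
rewrite -!mulr_sumr.
apply: (@le_trans _ _ (4 * eps * l.+1%:R)).
  by rewrite ler_wpM2l // mulr_ge0 ?ler0n ?(ltW eps0).
rewrite /eps le_eqVlt; apply/orP; left; apply/eqP.
by field; rewrite nat1r pnatr_eq0.
Qed.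

(** The squared distance from the barycentre to u attains its infimum, which is
    0, on the compact closure of the set of Gibbs weights. *)
Lemma moment_surjective (R : realType) (n l : nat)
    (m : 'I_l.+1 -> 'rV[int]_n) (u : 'rV[R]_n) :
  conv_hull m u ->
  exists p, [/\ closure (range (@gibbs R n l m)) p, in_simplex p &
    moment m p = u].
Proof.
move=> hu; pose K := closure (range (@gibbs R n l m)).
have coordc i : continuous (fun p : 'rV[R]_l.+1 => p 0 i).
  exact: coord_continuous.
have Ksimplex p : K p -> in_simplex p.
  move=> Kp; split=> [i|].
    apply: (closure_preimage (@closed_ge R 0) (coordc i)) Kp.
    by move=> _ [s _ <-] /=; exact/ltW/gibbs_gt0.
  apply: (closure_preimage (@closed_eq R 1) (continuous_sum coordc)) Kp.
  by move=> _ [s _ <-]; exact: (gibbs_simplex m s).2.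
have cK : compact K.
  pose box : set 'rV[R]_l.+1 := [set v | forall j, [set` `[0, 1]] (v ord0 j)].
  have cbox : compact box.
    apply: (@rV_compact R l.+1 (fun=> [set` `[0, 1]])) => j.
    exact: segment_compact.
  apply: (subclosed_compact _ cbox); first exact: closed_closure.
  move=> p /Ksimplex[p0 p1] i; rewrite /= in_itv /= p0 /=.
  by rewrite -p1 (bigD1 i) //= lerDl sumr_ge0.
have K0 : K (gibbs m 0) by apply: subset_closure; exists 0.
pose err (p : 'rV[R]_l.+1) : R := \sum_j (moment m p 0 j - u 0 j) ^+ 2.
have cerr : continuous err.
  apply: continuous_sum => j p.
  apply: (@continuous_comp _ _ _
    (fun p : 'rV[R]_l.+1 => moment m p 0 j - u 0 j) (fun y => y ^+ 2)).
    move: p; apply: continuous_add; last by move=> q; exact: cst_continuous.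
    rewrite (_ : (fun p => _) =
        fun p : 'rV[R]_l.+1 => \sum_i p 0 i * (m i 0 j)%:~R).
      apply: continuous_sum => i; apply: continuous_mul => [|q].
        exact: coord_continuous.
      exact: cst_continuous.
    by apply/funext => q; rewrite momentE.
  exact: exprn_continuous.
have [p] := EVT_min_rV (ex_intro _ _ K0) cK (continuous_subspaceT cerr).
rewrite inE => Kp pmin; exists p; split=> //; first exact: Ksimplex.
have err0 : err p = 0.
  apply/eqP; rewrite eq_le sumr_ge0 => [|j _]; last by rewrite sqr_ge0.
  rewrite andbT; apply/ler_addgt0Pl => e e0; rewrite addr0.
  have [s] := moment_approx hu e0; apply: le_trans; apply: pmin.
  by rewrite inE; apply: subset_closure; exists s.
apply/rowP => j; apply/eqP; rewrite -subr_eq0 -sqrf_eq0; apply/eqP.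
exact: (psumr_eq0P (fun j _ => sqr_ge0 _) err0).
Qed.

(** * Injectivity of the moment map over positive points *)

(** A linear system with integer coefficients has a rational kernel basis, which
    remains a kernel basis over the reals; clearing denominators makes it
    integral. *)
Lemma integer_kernel (k q : nat) (M : 'M[int]_(k, q)) :
  exists2 N : 'M[int]_k, N *m M = 0 &
    forall (R : realType) (w : 'rV[R]_k), w *m map_mx intr M = 0 ->
      exists r : 'rV[R]_k, w = r *m map_mx intr N.
Proof.
pose W : 'M[rat]_k := kermx (map_mx intr M).
have [p [a a0 Wp]] := rat_poly_scale (rVpoly (mxvec W)).
pose N : 'M[int]_k := vec_mx (poly_rV p).
have NW : map_mx intr N = a%:~R *: W.
  apply/matrixP => i j; rewrite [LHS]mxE [RHS]mxE [N i j]mxE [poly_rV p _ _]mxE.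
  have := congr1 (fun P : {poly rat} => P`_(mxvec_index i j)) Wp.
  rewrite coef_rVpoly_ord mxvecE coefZ coef_map /= => ->.
  by rewrite mulVKf // intr_eq0.
exists N.
  have NM : map_mx intr (N *m M) = 0 :> 'M[rat]_(k, q).
    by rewrite map_mxM NW -scalemxAl mulmx_ker scaler0.
  apply/matrixP => i j; have /matrixP/(_ i j) := NM.
  by rewrite mxE [RHS]mxE => /eqP; rewrite intr_eq0 => /eqP ->; rewrite mxE.
move=> R w wM.
have wW : (w <= map_mx (ratr : rat -> R) W)%MS.
  rewrite map_kermx -map_mx_comp.
  have /eq_map_mx -> : (ratr : rat -> R) \o intr =1 intr.
    by move=> z /=; rewrite ratr_int.
  exact/sub_kermxP.
have [r wr] := submxP wW.
exists ((a%:~R)^-1 *: r); rewrite wr -scalemxAl scalemxAr; congr (_ *m _).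
have -> : map_mx intr N = a%:~R *: map_mx (ratr : rat -> R) W.
  rewrite -[a%:~R](ratr_int R) -map_mxZ -NW -map_mx_comp.
  by apply: eq_map_mx => z /=; rewrite ratr_int.
by rewrite scalerA mulVf ?scale1r // intr_eq0.
Qed.

(** Multiply the real coefficients r by a large T and take integer parts.  This
    moves the i-th entry of the combination by at most B_i = sum_j |N_ji|, so T
    need only exceed B_i / w_i for each positive entry w_i. *)
Lemma integer_relation_pos (R : realType) (k : nat) (N : 'M[int]_k)
    (r : 'rV[R]_k) :
  exists y : 'rV[int]_k, forall i,
    0 < (r *m map_mx intr N) 0 i -> 0 < (y *m N) 0 i.
Proof.
pose w i : R := (r *m map_mx intr N) 0 i.
pose B i : R := \sum_j `|(N j i)%:~R|.
(* Entries with w i = 0 contribute 0, inversion being total. *)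
pose T : R := \sum_i (B i + 1) / `|w i|.
exists (\row_j Num.floor (T * r 0 j)) => i wi.
have B0 i' : 0 <= B i' by apply: sumr_ge0.
have TB : B i < T * w i.
  have : (B i + 1) / `|w i| <= T.
    rewrite /T [leRHS](bigD1 i) //= lerDl sumr_ge0 // => j _.
    by rewrite divr_ge0 // addr_ge0.
  rewrite gtr0_norm // ler_pdivrMr //; lra.
rewrite -(ltr_int R) mulr0z mxE rmorph_sum /=.
apply: (@lt_le_trans _ _ (T * w i - B i)); first by rewrite subr_gt0.
rewrite /w mxE mulr_sumr -sumrB; apply: ler_sum => j _.
rewrite !mxE rmorphM /= lerBlDr -lerBlDl mulrA -mulrBl.
apply: (le_trans (ler_norm _)); rewrite normrM ler_piMl //.
have /andP[] := floor_itv (T * r 0 j); rewrite intrD => h1 h2.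
by rewrite ger0_norm ?subr_ge0 //; lra.
Qed.

Definition pospart (z : int) : nat := if z is Posz k then k else 0%N.

Lemma pospartB (z : int) : z = (pospart z)%:Z - (pospart (- z))%:Z.
Proof. by case: z => [[|k]|k]; rewrite ?subr0 // NegzE opprK /= sub0r. Qed.

Lemma pospart_gt0 (z : int) : (0 < pospart z)%N = (0 < z).
Proof. by case: z. Qed.

(** Its left kernel consists of the affine relations among the m_i. *)
Definition exponent_matrix (n l : nat) (m : 'I_l.+1 -> 'rV[int]_n) :
    'M[int]_(l.+1, 1 + n) :=
  row_mx (const_mx 1) (\matrix_(i, j) m i 0 j).

Lemma mul_exponent_matrix (A : pzRingType) (n l : nat)
    (m : 'I_l.+1 -> 'rV[int]_n) (z : 'rV[A]_l.+1) :
  z *m map_mx intr (exponent_matrix m) = 0 <->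
  \sum_i z 0 i = 0 /\ forall j, \sum_i z 0 i * (m i 0 j)%:~R = 0.
Proof.
rewrite /exponent_matrix map_row_mx mul_mx_row -row_mx0.
have E1 : z *m map_mx intr (const_mx 1 : 'M[int]_(l.+1, 1)) =
    const_mx (\sum_i z 0 i).
  apply/matrixP => i j; rewrite !mxE ord1.
  by apply: eq_bigr => k _; rewrite !mxE mulr1.
have E2 : z *m map_mx intr (\matrix_(i, j) m i 0 j) =
    \row_j \sum_i z 0 i * (m i 0 j)%:~R.
  by apply/rowP => j; rewrite !mxE; apply: eq_bigr => i _; rewrite !mxE.
rewrite E1 E2; split=> [/eq_row_mx[/matrixP/(_ 0 0) z1 /rowP z2]|[z1 z2]].
  by move: z1; rewrite !mxE => z1; split=> // j; have := z2 j; rewrite !mxE.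
congr row_mx; first by rewrite z1; apply/matrixP => i j; rewrite !mxE.
by apply/rowP => j; rewrite !mxE z2.
Qed.

Lemma toric_relation (R : realType) (n l : nat) (m : 'I_l.+1 -> 'rV[int]_n)
    (x : projspace R[i] l) (p : 'rV[R]_l.+1) (z : 'rV[int]_l.+1) :
  toric_variety m x -> has_coords x (complexify p) ->
  z *m exponent_matrix m = 0 ->
  \prod_i p 0 i ^+ pospart (z 0 i) = \prod_i p 0 i ^+ pospart (- z 0 i).
Proof.
move=> Yx xp; have -> : exponent_matrix m = map_mx intr (exponent_matrix m).
  by apply/matrixP => i j; rewrite !mxE; exact: esym (intz _).
move=> /mul_exponent_matrix[z1 z2]; apply: toric_binomial Yx xp _ _.
  apply/eqP; rewrite -eqz_nat !(big_morph Posz PoszD (erefl _)).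
  rewrite -subr_eq0 -sumrB -[X in _ == X]z1; apply/eqP.
  by apply: eq_bigr => i _; rewrite -pospartB.
apply/rowP => j; rewrite !summxE; apply/eqP; rewrite -subr_eq0 -sumrB.
rewrite -[X in _ == X](z2 j); apply/eqP; apply: eq_bigr => i _.
have E d : m i 0 j *+ d = d%:Z * m i 0 j by rewrite -mulr_natl natz.
by rewrite !mulmxnE !E -mulrBl -pospartB intz.
Qed.

(** If p_i = 0, the relation q - p is positive at every zero of p, and so is
    some integer relation z.  In the binomial of z, the side carrying the
    positive exponents vanishes at p because of index i, while the other side
    only involves coordinates where p is nonzero. *)
Lemma toric_fibre_pos (R : realType) (n l : nat) (m : 'I_l.+1 -> 'rV[int]_n)
    (x : projspace R[i] l) (p q : 'rV[R]_l.+1) :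
  toric_variety m x -> in_simplex p -> has_coords x (complexify p) ->
  in_simplex q -> (forall i, 0 < q 0 i) -> moment m p = moment m q ->
  forall i, 0 < p 0 i.
Proof.
move=> Yx [p0 p1] xp [_ q1] q0 mpq i.
rewrite lt_neqAle p0 andbT eq_sym; apply/negP => /eqP pi0.
have [N NM Nker] := integer_kernel (exponent_matrix m).
have /Nker[r wr] : (q - p) *m map_mx intr (exponent_matrix m) = 0.
  apply/mul_exponent_matrix; split=> [|j].
    by under eq_bigr do rewrite !mxE; rewrite sumrB p1 q1 subrr.
  under eq_bigr do rewrite !mxE mulrBl.
  by rewrite sumrB -!momentE mpq subrr.
have [y ypos] := integer_relation_pos N r.
have zpos k : p 0 k = 0 -> 0 < (y *m N) 0 k.
  by move=> pk; apply: ypos; rewrite -wr !mxE pk subr0.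
have := toric_relation (z := y *m N) Yx xp.
rewrite -mulmxA NM mulmx0 => /(_ erefl); rewrite (bigD1 i) //= pi0.
rewrite expr0n eqn0Ngt pospart_gt0 zpos // mul0r => /esym/eqP; apply/negP.
apply/prodf_neq0 => k _; apply/negP; rewrite expf_eq0 pospart_gt0.
move=> /andP[z_lt0 /eqP/zpos z_gt0]; move: z_lt0; rewrite oppr_gt0.
by move=> /(lt_trans z_gt0); rewrite ltxx.
Qed.

(** For an integer relation this is the logarithm of a binomial equation, and
    integer relations span the real ones. *)
Lemma toric_ln_relation (R : realType) (n l : nat)
    (m : 'I_l.+1 -> 'rV[int]_n) (x : projspace R[i] l) (p : 'rV[R]_l.+1) :
  toric_variety m x -> has_coords x (complexify p) ->
  (forall i, 0 < p 0 i) ->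
  forall w : 'rV[R]_l.+1, w *m map_mx intr (exponent_matrix m) = 0 ->
  \sum_i w 0 i * ln (p 0 i) = 0.
Proof.
move=> Yx xp p0; have [N NM Nker] := integer_kernel (exponent_matrix m).
have lnprod (e : 'I_l.+1 -> nat) :
    ln (\prod_i p 0 i ^+ e i) = \sum_i (e i)%:R * ln (p 0 i).
  apply: expR_inj; rewrite lnK ?posrE ?prodr_gt0 // => [|i _]; last first.
    exact: exprn_gt0.
  rewrite expR_sum; apply: eq_bigr => i _.
  by rewrite mulrC expRM_natr lnK ?posrE.
have Nln k : \sum_i (N k i)%:~R * ln (p 0 i) = 0.
  have : row k N *m exponent_matrix m = 0 by rewrite -row_mul NM row0.
  move=> /(toric_relation Yx xp)/(congr1 (@ln R)); rewrite !lnprod.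
  move=> /eqP; rewrite -subr_eq0 -sumrB => /eqP e0; rewrite -[RHS]e0.
  apply: eq_bigr => i _; rewrite -mulrBl mxE; congr (_ * _).
  by rewrite {1}(pospartB (N k i)) rmorphB.
move=> _ /Nker[r ->]; under eq_bigr do rewrite mxE mulr_suml.
rewrite exchange_big big1 // => k _.
under eq_bigr do rewrite mxE -mulrA.
by rewrite -mulr_sumr Nln mulr0.
Qed.

(** Both logarithms are orthogonal to the relation q - p.  As ln is strictly
    increasing, the sum of the terms (q_i - p_i)(ln q_i - ln p_i) can only
    vanish termwise. *)
Lemma toric_fibre_unique (R : realType) (n l : nat)
    (m : 'I_l.+1 -> 'rV[int]_n) (x y : projspace R[i] l)
    (p q : 'rV[R]_l.+1) :
  toric_variety m x -> in_simplex p -> has_coords x (complexify p) ->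
  toric_variety m y -> in_simplex q -> has_coords y (complexify q) ->
  (forall i, 0 < q 0 i) -> moment m p = moment m q -> p = q.
Proof.
move=> Yx sp xp Yy sq yq q0 mpq.
have p0 := toric_fibre_pos Yx sp xp sq q0 mpq.
have ker : (q - p) *m map_mx intr (exponent_matrix m) = 0.
  apply/mul_exponent_matrix; split=> [|j].
    by under eq_bigr do rewrite !mxE; rewrite sumrB sp.2 sq.2 subrr.
  under eq_bigr do rewrite !mxE mulrBl.
  by rewrite sumrB -!momentE mpq subrr.
have sum0 : \sum_i (q 0 i - p 0 i) * (ln (q 0 i) - ln (p 0 i)) = 0.
  under eq_bigr do rewrite mulrBr.
  rewrite sumrB -[RHS](subrr 0); congr (_ - _).
    rewrite -[RHS](toric_ln_relation Yy yq q0 ker).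
    by apply: eq_bigr => i _; rewrite !mxE.
  rewrite -[RHS](toric_ln_relation Yx xp p0 ker).
  by apply: eq_bigr => i _; rewrite !mxE.
have term_ge0 i : 0 <= (q 0 i - p 0 i) * (ln (q 0 i) - ln (p 0 i)).
  have [le_qp|lt_pq] := lerP (q 0 i) (p 0 i).
    by rewrite mulr_le0 // subr_le0 // ler_ln ?posrE.
  by rewrite mulr_ge0 // subr_ge0 ?ler_ln ?posrE // ltW.
apply/rowP => i; apply/esym/eqP.
have /(_ i isT) := psumr_eq0P (fun j _ => term_ge0 j) sum0.
move=> /eqP; rewrite mulf_eq0 !subr_eq0 => /orP[//|/eqP ln_qp].
by apply/eqP; apply: ln_inj ln_qp; rewrite posrE.
Qed.

(** * Linear independence of Laurent monomials at positive points *)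

(** Look for s on the moment curve (1, x, ..., x^(n-1)): a difference of two
    pairings is then a nonzero polynomial in x, and some x is a root of none
    of these finitely many polynomials. *)
Lemma separating_direction (R : realType) (n l : nat)
    (m : 'I_l.+1 -> 'rV[int]_n) :
  injective m -> exists s : 'rV[R]_n, injective (fun i => pairing s (m i)).
Proof.
move=> m_inj.
pose P i k : {poly R} := \poly_(j < n)
  (if insub j is Some j' then (m i 0 j')%:~R - (m k 0 j')%:~R else 0).
have P_neq0 i k : i != k -> P i k != 0.
  apply: contra_neq => P0; apply: m_inj; apply/rowP => j.
  have := congr1 (fun Q : {poly R} => Q`_j) P0.
  rewrite coef_poly ltn_ord coef0 valK => /eqP.
  by rewrite subr_eq0 eqr_int => /eqP.
have PE i k x : (P i k).[x] =
    pairing (\row_j x ^+ j) (m i) - pairing (\row_j x ^+ j) (m k).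
  rewrite horner_poly -sumrB; apply: eq_bigr => j _.
  by rewrite valK mxE mulrC mulrBr.
pose Q := \prod_(ik : 'I_l.+1 * 'I_l.+1 | ik.1 != ik.2) P ik.1 ik.2.
have Q_neq0 : Q != 0 by apply/prodf_neq0 => ik; exact: P_neq0.
have [x Qx] : exists x, ~~ root Q x.
  pose rs : seq R := [seq j%:R | j <- iota 0 (size Q)].
  have /allPn[x _ Qx] : ~~ all (root Q) rs; last by exists x.
  apply/negP => /(max_poly_roots Q_neq0); rewrite size_map size_iota ltnn.
  suff -> : uniq rs by move=> /(_ isT).
  by rewrite map_inj_uniq ?iota_uniq //; exact: mulrIn (oner_neq0 R).
exists (\row_j x ^+ j) => i k /eqP; rewrite -subr_eq0 -PE => Pik.
apply/eqP; apply: contraT => ik; move: Qx.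
by rewrite rootE horner_prod (bigD1 (i, k)) //= (eqP Pik) mul0r eqxx.
Qed.

(** Vandermonde independence: by linearity the hypothesis holds for every
    polynomial in place of a power, in particular for the one that vanishes at
    all nodes but z_i. *)
Lemma power_sums_free (F : fieldType) (k : nat) (z c : 'I_k -> F) :
  injective z -> (forall d : nat, \sum_i c i * z i ^+ d = 0) ->
  forall i, c i = 0.
Proof.
move=> z_inj cz i.
have cpoly (P : {poly F}) : \sum_i c i * P.[z i] = 0.
  under eq_bigr do rewrite horner_coef mulr_sumr.
  rewrite exchange_big big1 // => d _.
  under eq_bigr do rewrite mulrCA.
  by rewrite -mulr_sumr cz mulr0.
have := cpoly (\prod_(j | j != i) ('X - (z j)%:P)).
rewrite (bigD1 i) //= [X in _ + X]big1 ?addr0 => [|j ji]; last first.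
  by rewrite horner_prod (bigD1 j) //= hornerXsubC subrr mul0r mulr0.
move=> /eqP; rewrite mulf_eq0 => /orP[/eqP //|]; rewrite horner_prod => /eqP P0.
have /eqP [] : \prod_(j | j != i) ('X - (z j)%:P).[z i] != 0; last exact: P0.
apply/prodf_neq0 => j ji; rewrite hornerXsubC subr_eq0.
by apply: contra_neq ji => /z_inj.
Qed.

(** Along the multiples d s of a separating direction, the exp<d s, m_i> are the
    d-th powers of distinct numbers. *)
Lemma gibbs_free (R : realType) (n l : nat) (m : 'I_l.+1 -> 'rV[int]_n)
    (c : 'I_l.+1 -> R) :
  injective m -> (forall s, \sum_i c i * gibbs m s 0 i = 0) ->
  forall i, c i = 0.
Proof.
move=> m_inj cg; have [s s_inj] := separating_direction R m_inj.
apply: (@power_sums_free _ _ (fun i => expR (pairing s (m i)))).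
  by move=> i k /expR_inj /s_inj.
move=> d; have := cg (s *+ d).
under eq_bigr do rewrite mxE mulrA.
rewrite -mulr_suml => /eqP.
rewrite mulf_eq0 invr_eq0 [X in _ || X]gt_eqF ?partition_function_gt0 ?orbF //.
move=> /eqP e0; rewrite -[RHS]e0; apply: eq_bigr => i _.
rewrite -expRM_natr; congr (_ * expR _).
rewrite mulr_suml; apply: eq_bigr => j _.
by rewrite mulmxnE mulr_natr mulrnAl.
Qed.

(** * Linear precision *)

Lemma moment_conv_hull (R : realType) (n l : nat) (m : 'I_l.+1 -> 'rV[int]_n)
    (p : 'rV[R]_l.+1) : in_simplex p -> conv_hull m (moment m p).
Proof. by move=> [p0 p1]; exists (fun i => p 0 i); split. Qed.

Lemma alpha_invP (R : realType) (n l : nat) (m : 'I_l.+1 -> 'rV[int]_n)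
    (u : 'rV[R]_n) :
  conv_hull m u ->
  toric_nonneg m (alpha_inv m u) /\ alpha m (alpha_inv m u) = u.
Proof.
have surj : set_surj (@toric_nonneg R n l m) (conv_hull m) (alpha m).
  move=> _ /moment_surjective[p [Kp sp <-]].
  pose x : projspace R[i] l := proj_class (complexify_neq0 sp).
  have xp : has_coords x (complexify p) by exists (complexify_neq0 sp).
  exists x; last exact: alpha_moment.
  exact: toric_nonneg_real (toric_closure Kp xp) sp xp.
move=> hu; split; last by rewrite [LHS](surjpK _ surj) // inE.
by apply: (surjpinv_image_sub surj); exists u.
Qed.

Theorem theorem8p6 (R : realType) (n l : nat) (m : 'I_l.+1 -> 'rV[int]_n)
    (m_inj : injective m) (f : 'I_l.+1 -> 'rV[R]_n -> R)
    (f_coords : alpha_inv_coordinates m f) :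
  linear_precision m f.
Proof.
pose F u : 'rV[R]_l.+1 := \row_i f i u.
have F_simplex u : conv_hull m u -> in_simplex (F u).
  move=> /f_coords[f0 f1 _]; split=> [i|]; first by rewrite mxE.
  by under eq_bigr do rewrite mxE.
have F_coords u :
    conv_hull m u -> has_coords (alpha_inv m u) (complexify (F u)).
  move=> /f_coords[_ _]; congr has_coords.
  by apply/rowP => i; rewrite !mxE.
have F_moment u : conv_hull m u -> moment m (F u) = u.
  move=> hu; rewrite -(alpha_moment m (F_simplex _ hu) (F_coords _ hu)).
  exact: (alpha_invP hu).2.
split=> [c cf|Lam [L [b LamE]] u hu].
  apply: (gibbs_free m_inj) => s.
  have hu := moment_conv_hull m (gibbs_simplex m s).
  have <- : F (moment m (gibbs m s)) = gibbs m s.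
    apply: (toric_fibre_unique (alpha_invP hu).1.1 (F_simplex _ hu)
      (F_coords _ hu) _ (gibbs_simplex m s) (phi_gibbs m s)).
    - by move=> Z [_]; apply; exists (exp_torus s).
    - exact: gibbs_gt0.
    - exact: F_moment.
  by rewrite -[RHS](cf _ hu); apply: eq_bigr => i _; rewrite mxE.
have [_ f1 _] := f_coords _ hu.
under eq_bigr do rewrite LamE mulrDl.
rewrite big_split /= -mulr_sumr f1 mulr1 LamE; congr (_ + b).
rewrite -[in LHS](F_moment _ hu) linear_sum /=; apply: eq_bigr => i _.
by rewrite linearZ /= mxE mulrC.
Qed.
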